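(* Let $G$ be a triangle-free graph that is gap-critical. Then every connected component of $G$ is factor-critical.
   Context: All graphs are finite and simple. $\theta(G)$ is the minimum number of cliques covering $V(G)$, $\alpha(G)$ the maximum size of a stable set, and $\mathrm{gap}(G)=\theta(G)-\alpha(G)$. A graph $G$ is gap-critical if for every vertex $v$ of $G$, $\mathrm{gap}(G\setminus v)<\mathrm{gap}(G)$. A graph is factor-critical if deleting any one of its vertices yields a graph with a perfect matching. *)

(* Defs.v *)
From mathcomp Require Import all_boot all_order all_algebra.

Set Implicit Arguments.
Unset Strict Implicit.
Unset Printing Implicit Defensive.

Record sgraph := SGraph {
  vertex :> finType;
  adj : rel vertex;
  adj_sym : symmetric adj;
  adj_irr : irreflexive adj }.

Notation "x -- y" := (adj x y) (at level 30).

Section Induced.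
Variables (G : sgraph) (S : {set G}).

Definition induced_adj : rel {x : G | x \in S} := fun x y => val x -- val y.

Lemma induced_sym : symmetric induced_adj.
Proof. by move=> x y; apply: adj_sym. Qed.

Lemma induced_irr : irreflexive induced_adj.
Proof. by move=> x; apply: adj_irr. Qed.

Definition induced : sgraph := SGraph induced_sym induced_irr.
End Induced.

Definition del_vertex (G : sgraph) (v : G) : sgraph := induced [set~ v].

Section Invariants.
Variable G : sgraph.

Definition triangle_free : Prop :=
  forall x y z : G, ~ [/\ x -- y, y -- z & x -- z].

Definition clique (K : {set G}) : bool :=
  [forall x in K, forall y in K, (x != y) ==> x -- y].

Definition stable (S : {set G}) : bool :=
  [forall x in S, forall y in S, ~~ (x -- y)].

Definition clique_cover (P : {set {set G}}) : bool :=
  [forall K in P, clique K] && (cover P == [set: G]).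

Lemma clique_cover_ex :
  exists k, [exists P : {set {set G}}, clique_cover P && (#|P| == k)].
Proof.
set P := [set [set x] | x : G].
exists #|P|; apply/existsP; exists P; rewrite eqxx andbT; apply/andP; split.
  apply/forall_inP=> _ /imsetP[z _ ->].
  apply/forall_inP=> x /set1P->; apply/forall_inP=> y /set1P->.
  by rewrite eqxx.
apply/eqP/setP=> x; rewrite inE; apply/bigcupP.
by exists [set x]; rewrite ?set11 ?imset_f.
Qed.

Definition theta : nat := ex_minn clique_cover_ex.

Definition alpha : nat := \max_(S : {set G} | stable S) #|S|.

(* An integer difference, so that no truncation is involved. *)
Definition gap : int := (theta%:Z - alpha%:Z)%R.

Definition components : {set {set G}} :=
  [set [set y | connect (@adj G) x y] | x : G].

Definition edges : {set {set G}} :=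
  [set [set p.1; p.2] | p : G * G & p.1 -- p.2].

Definition perfect_matching (M : {set {set G}}) : bool :=
  [&& M \subset edges, trivIset M & cover M == [set: G]].

End Invariants.

Definition gap_critical (G : sgraph) : Prop :=
  forall v : G, (gap (del_vertex v) < gap G)%R.

Definition factor_critical (G : sgraph) : Prop :=
  forall v : G, exists M : {set {set del_vertex v}}, perfect_matching M.

(* Main.v *)
Require Import Defs.
From mathcomp Require Import all_boot all_order all_algebra.
From mathcomp Require Import zify.

(** In a triangle-free graph cliques have at most two vertices, so clique
    covers of size theta correspond to maximum matchings.  Since alpha does not
    increase when a vertex v is deleted, gap-criticality forces
    theta(G \ v) < theta(G), i.e. some maximum matching misses v.  Gallai's
    argument then shows that "no maximum matching misses both" is a transitive
    relation containing adjacency, so a maximum matching missing v in C matches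
    the rest of the component C perfectly. *)

Set Implicit Arguments.
Unset Strict Implicit.
Unset Printing Implicit Defensive.

(** * Matchings and Gallai's exchange argument *)

Section Matchings.
Variable G : sgraph.
Implicit Types (f g : {ffun G -> G}) (x y z v : G).

(* Matchings are encoded as involutions moving each vertex to a neighbour or
   fixing it; the fixed points are the vertices missed by the matching. *)
Definition matching f : Prop :=
  involutive f /\ forall x, f x != x -> x -- f x.

Definition missed f : {set G} := [set x | f x == x].

Definition max_matching f : Prop :=
  matching f /\ forall g, matching g -> #|missed f| <= #|missed g|.

(* Adds the edge [x y] and drops the edge of [f] at [y], if any. *)
Definition exchange f x y : {ffun G -> G} :=
  [ffun a => if a == x then y else if a == y then x
             else if a == f y then a else f a].

Lemma adj_neq x y : x -- y -> x != y.
Proof. by apply: contraTneq => ->; rewrite adj_irr. Qed.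

Lemma exchange_matching f x y :
  matching f -> f x = x -> x -- y -> matching (exchange f x y).
Proof.
move=> [fK fadj] fx xy; have nxy := adj_neq xy.
split=> a; rewrite !ffunE.
  case: (eqVneq a x) => [->|nax]; first by rewrite eq_sym (negPf nxy) eqxx.
  case: (eqVneq a y) => [->|nay]; first by rewrite eqxx.
  case: (eqVneq a (f y)) => [afy|nafy].
    by rewrite (negPf nax) (negPf nay) afy eqxx.
  rewrite (inv_eq fK) fx (negPf nax) (inv_eq fK) (negPf nafy).
  by rewrite (inj_eq (inv_inj fK)) (negPf nay) fK.
case: (eqVneq a x) => [->|nax]; first by [].
case: (eqVneq a y) => [->|nay]; first by rewrite adj_sym.
by case: (eqVneq a (f y)) => [_|_]; rewrite ?eqxx //; apply: fadj.
Qed.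

Lemma missed_exchange f x y : x -- y ->
  missed (exchange f x y) = (f y |: missed f) :\ x :\ y.
Proof.
move=> xy; have nxy := adj_neq xy; apply/setP=> a; rewrite !inE !ffunE.
case: (eqVneq a x) => [->|nax].
  by rewrite eq_sym (negPf nxy) andbF.
case: (eqVneq a y) => [->|nay]; first by rewrite (negPf nxy).
by case: (eqVneq a (f y)) => [_|_]; rewrite ?eqxx.
Qed.

(** If [f] fixed both ends, adding the edge would give a matching with strictly fewer missed
    vertices, [x] being one that drops out. *)
Lemma max_matching_adj f x y :
  max_matching f -> x -- y -> f x = x -> f y <> y.
Proof.
move=> [mf maxf] xy fx fy.
have := maxf _ (exchange_matching mf fx xy); rewrite leqNgt => /negP; apply.
apply/proper_card/properP; split.
  apply/subsetP=> a; rewrite missed_exchange // !inE fy.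
  by case/and3P=> /negPf->.
by exists x; rewrite ?missed_exchange // !inE ?fx ?eqxx ?andbF.
Qed.

(** The vertex [x] leaves the missed set and at most [f y] enters it. *)
Lemma max_matching_exchange f x y :
  max_matching f -> f x = x -> x -- y -> max_matching (exchange f x y).
Proof.
move=> maxf fx xy; have [mf minf] := maxf.
split=> [|g mg]; first exact: exchange_matching.
apply: leq_trans (minf g mg).
have xm : x \in missed f by rewrite inE fx.
rewrite missed_exchange // (leq_trans (subset_leq_card (subsetDl _ _))) //.
have xm' : x \in f y |: missed f by rewrite inE xm orbT.
rewrite (cardsD1 x (missed f)) xm.
have := cardsU1 (f y) (missed f); have := cardsD1 x (f y |: missed f).
by rewrite xm'; have := cardsD1 x (missed f); rewrite xm; case: (f y \notin _); lia.
Qed.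

(** Concluding [x = y] keeps the relation reflexive, as paths of length zero require. *)
Definition never_both_missed x y : Prop :=
  forall f, max_matching f -> f x = x -> f y = y -> x = y.

Hypothesis missable : forall v, exists2 f, max_matching f & f v = v.

Lemma never_both_missed_trans v u w :
  never_both_missed u v -> never_both_missed v w -> never_both_missed u w.
Proof.
move=> uv vw f maxf fu fw; apply/eqP/negPn/negP=> nuw.
have fv : f v != v.
  by apply: contraNneq nuw => fv; rewrite (uv f) // (vw f).
have [g0 maxg0 g0v] := missable v.
(* Among the maximum matchings missing [v], one agreeing most with [f] could
   still be exchanged towards [f]. *)
have improve n g : max_matching g -> g v = v ->
    #|[set a | f a != g a]| < n -> False.
  elim: n g => // n IHn g maxg gv; rewrite ltnS => len.
  have [[fK fadj] minf] := maxf; have [[gK gadj] ming] := maxg.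
  have gu : g u != u.
    by apply: contraNneq fv => gu; rewrite -(uv g maxg gu gv) fu.
  have gw : g w != w.
    by apply: contraNneq fv => gw; rewrite (vw g maxg gv gw) fw.
  (* Both matchings miss equally many vertices, and [u] and [w] are missed by [f] alone. So at least
     two vertices are missed by [g] alone, one of them not [v]. *)
  have [x [xg nxv fx]] : exists x, [/\ g x = x, x != v & f x != x].
    have eqc : #|missed f| = #|missed g|.
      by apply/eqP; rewrite eqn_leq minf // ming.
    have : 1 < #|missed g :\: missed f|.
      have -> : #|missed g :\: missed f| = #|missed f :\: missed g|.
        by rewrite !cardsD eqc setIC.
      apply: leq_trans (subset_leq_card (_ : [set u; w] \subset _)).
        by rewrite cards2 nuw.
      by apply/subsetP=> a /set2P[]->; rewrite !inE ?gu ?gw ?fu ?fw eqxx.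
    rewrite (cardsD1 v) ltnNge.
    have [->|] := set_0Vmem ((missed g :\: missed f) :\ v).
      by rewrite cards0 addn0 leq_b1.
    move=> [x]; rewrite !inE => /and3P[nxv fx /eqP gx] _.
    by exists x.
  pose y := f x; have xy : x -- y by apply: fadj.
  have nxy := adj_neq xy.
  have gy : g y <> y by apply: max_matching_adj xg.
  apply: (IHn (exchange g x y)).
  - exact: max_matching_exchange.
  - rewrite ffunE eq_sym (negPf nxv); case: eqP => [vy|_].
      by case: gy; rewrite -vy.
    by case: eqP.
  apply: leq_trans len; apply: proper_card; apply/properP; split.
    apply/subsetP=> a; rewrite !inE ffunE.
    case: (eqVneq a x) => [->|nax]; first by rewrite eqxx.
    case: (eqVneq a y) => [->|nay]; first by rewrite fK eqxx.
    (* The change at [g y] costs nothing, since [f] and [g] already differed there: [f (g y) = y]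
       would give [g y = x], but [g] fixes [x]. *)
    case: (eqVneq a (g y)) => [-> _|//]; rewrite gK (inv_eq fK) fK.
    by apply: contra_eqN xg => /eqP gyx; rewrite -{1}gyx gK eq_sym.
  by exists x; rewrite !inE ?ffunE ?eqxx // xg.
exact: (improve _ g0 maxg0 g0v (ltnSn _)).
Qed.

Lemma connect_never_both_missed x y :
  connect (@adj G) x y -> never_both_missed x y.
Proof.
case/connectP=> p; elim: p x => [|z p IHp] x /=; first by move=> _ ->.
case/andP=> xz pz yz; apply: never_both_missed_trans (IHp z pz yz).
by move=> f maxf fx fz; case: (max_matching_adj maxf xz).
Qed.

End Matchings.

(** * Clique covers versus matchings *)

Section Theta.
Variable G : sgraph.
Implicit Types (f : {ffun G -> G}) (P : {set {set G}}) (K : {set G}).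

Lemma cliqueP K :
  reflect {in K &, forall x y, x != y -> x -- y} (clique K).
Proof.
apply: (iffP forall_inP) => [cK x y xK yK|cK x xK].
  by move: (cK x xK) => /forall_inP/(_ y yK)/implyP.
by apply/forall_inP=> y yK; apply/implyP; apply: cK.
Qed.

Lemma theta_le P : clique_cover P -> theta G <= #|P|.
Proof.
move=> cP; rewrite /theta; case: ex_minnP => k _; apply.
by apply/existsP; exists P; rewrite cP eqxx.
Qed.

Lemma theta_attained :
  exists2 P : {set {set G}}, clique_cover P & #|P| = theta G.
Proof.
rewrite /theta; case: ex_minnP => k /existsP[P /andP[cP /eqP <-]] _.
by exists P.
Qed.

(** For an involution this is twice the number of orbits; the sum form can be split clique by
    clique. *)
Lemma card_missed f :
  #|G| + #|missed f| = \sum_(x : G) (1 + (f x == x)).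
Proof.
rewrite big_split /= sum1_card -sum1dep_card big_mkcond /=; congr (_ + _).
Qed.

Lemma matching_theta f : matching f -> 2 * theta G <= #|G| + #|missed f|.
Proof.
move=> [fK fadj]; pose b x := [set x; f x].
have cP : clique_cover [set b x | x : G].
  apply/andP; split.
    apply/forall_inP=> _ /imsetP[z _ ->]; apply/cliqueP=> x y.
    move=> /set2P[]-> /set2P[]->; rewrite ?eqxx // => n.
      by apply: fadj; rewrite eq_sym.
    by rewrite adj_sym; apply: fadj.
  apply/eqP/setP=> x; rewrite inE; apply/bigcupP.
  by exists (b x); rewrite ?imset_f // set21.
apply: leq_trans (leq_mul (leqnn 2) (theta_le cP)) _.
rewrite card_missed (partition_big b (mem [set b x | x : G])) /=; last first.
  by move=> x _; apply: imset_f.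
rewrite mulnC -sum_nat_const; apply: leq_sum => _ /imsetP[z _ ->].
rewrite (bigD1 z) //=; case: eqVneq => // nfz.
rewrite (bigD1 (f z)) ?fK ?nfz /=; first by lia.
by rewrite /b fK setUC eqxx.
Qed.

Hypothesis triG : triangle_free G.

(** Without triangles a clique has at most two vertices, so a matching can pair them. The condition
    on [v] keeps it unpaired. *)
Lemma clique_cover_matching P v :
    clique_cover P -> (forall K, K \in P -> v \in K -> K = [set v]) ->
  exists f, [/\ matching f, f v = v & #|G| + #|missed f| <= 2 * #|P|].
Proof.
case/andP=> /forall_inP cP /eqP covP vP.
(* Cliques of [P] may overlap; choosing one clique [K x] per vertex gives disjoint fibres. *)
have /fin_all_exists2[K KP xK] x : exists2 K, K \in P & x \in K.
  by apply/bigcupP; rewrite -/(cover P) covP inE.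
have Kadj x y : K x = K y -> x != y -> x -- y.
  move=> eK; apply: (cliqueP _ (cP _ (KP x))) => //.
  by rewrite eK.
have K3 x y z : K x = K y -> K x = K z -> x != y -> x != z -> y = z.
  move=> exy exz nxy nxz; apply/eqP/negPn/negP=> nyz.
  apply: (triG (x := x) (y := y) (z := z)); split; apply: Kadj => //.
  by rewrite -exy.
(* The other vertex of the fibre of [x], or [x] itself if it is alone. *)
pose f := [ffun x => odflt x [pick y | (y != x) && (K y == K x)]].
have fP x : K (f x) = K x.
  by rewrite ffunE; case: pickP => //= y /andP[_ /eqP].
have fmax x y : K y = K x -> y != x -> f x = y.
  move=> e n; rewrite ffunE; case: pickP => [z /= /andP[nz /eqP ez]|/(_ y)].
    by apply: (K3 x); rewrite // eq_sym.
  by rewrite n e eqxx.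
exists f; split.
- split=> [x|x nx]; last by apply: Kadj; rewrite ?fP // eq_sym.
  case: (eqVneq (f x) x) => [e|n]; first by rewrite !e.
  by apply: fmax; rewrite ?fP // eq_sym.
- have := xK (f v); rewrite fP (vP (K v)) ?KP ?xK //.
  by move/set1P.
rewrite card_missed (partition_big K (mem P)) /=; last by move=> x _; apply: KP.
rewrite mulnC -sum_nat_const; apply: leq_sum => B _.
(* A fibre with one or two vertices contributes exactly 2, an empty one 0. *)
case: (pickP (fun x => K x == B)) => [x /eqP xB|B0]; last by rewrite big_pred0.
have fib y : K y == B -> y = x \/ y = f x.
  move/eqP=> yB; case: (eqVneq y x) => [|n]; first by left.
  by right; rewrite (fmax x y) // yB.
rewrite (bigD1 x) ?xB //=; case: (eqVneq (f x) x) => [e|n].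
  rewrite big_pred0 // => y; apply/negP=> /andP[/fib[]->]; rewrite ?e eqxx //.
rewrite (bigD1 (f x)) ?fP ?xB ?eqxx //= big_pred0.
  have -> : f (f x) = x by apply: fmax; rewrite ?fP // eq_sym.
  by rewrite eq_sym (negPf n).
by move=> y; apply/negP=> /andP[/andP[/fib[]->]]; rewrite eqxx.
Qed.

End Theta.

(** * Consequences of gap-criticality *)

Lemma alpha_induced (G : sgraph) (S : {set G}) : alpha (induced S) <= alpha G.
Proof.
apply/bigmax_leqP=> T sT; rewrite -(card_imset _ val_inj).
apply: (@leq_bigmax_cond _ (@stable G) (fun T : {set G} => #|T|)).
apply/forall_inP=> _ /imsetP[x xT ->]; apply/forall_inP=> _ /imsetP[y yT ->].
by have /forall_inP/(_ x xT)/forall_inP/(_ y yT) := sT.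
Qed.

(** Adding [[set v]] to a minimum cover of the graph without [v] gives a cover of [G] by at most
    [theta G] cliques. The matching it yields misses [v] and attains the bound of [matching_theta],
    so it is maximum. *)
Lemma gap_critical_missable (G : sgraph) (v : G) :
  triangle_free G -> gap_critical G ->
  exists2 f : {ffun G -> G}, max_matching f & f v = v.
Proof.
move=> triG /(_ v); rewrite /gap => critv.
have lt_theta : theta (del_vertex v) < theta G.
  by have := alpha_induced [set~ v]; move: critv; rewrite -/(del_vertex v); lia.
have [P cP szP] := theta_attained (del_vertex v).
have valv (x : del_vertex v) : val x != v.
  by have := valP x; rewrite !inE.
pose Q : {set {set G}} :=
  [set v] |: [set [set val x | x in K] | K : {set del_vertex v} in P].
have cQ : clique_cover Q.
  case/andP: cP => /forall_inP cP /eqP covP; apply/andP; split.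
    apply/forall_inP=> K /setU1P[->|/imsetP[L LP ->]]; apply/cliqueP.
      by move=> x y /set1P-> /set1P->; rewrite eqxx.
    move=> _ _ /imsetP[x xL ->] /imsetP[y yL ->] n.
    by apply: (cliqueP _ (cP L LP)) => //; apply: contraNneq n => ->.
  apply/eqP/setP=> x; rewrite inE; apply/bigcupP.
  case: (eqVneq x v) => [->|n]; first by exists [set v]; rewrite ?setU11 ?set11.
  have xS : x \in [set~ v] by rewrite !inE.
  have : (Sub x xS : del_vertex v) \in cover P by rewrite covP inE.
  case/bigcupP=> L LP xL; exists [set val x | x in L].
    by apply/setU1P; right; apply: imset_f.
  by apply/imsetP; exists (Sub x xS); rewrite ?SubK.
have vQ K : K \in Q -> v \in K -> K = [set v].
  case/setU1P=> // /imsetP[L _ ->] /imsetP[x _ e].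
  by have := valv x; rewrite -e eqxx.
have [f [mf fv szf]] := clique_cover_matching triG cQ vQ.
exists f => //; split=> // g mg.
have szQ : #|Q| <= theta G.
  apply: leq_trans lt_theta; rewrite -szP cardsU1.
  by apply: (leq_add (leq_b1 _)); apply: leq_imset_card.
by have := matching_theta mg; lia.
Qed.

(** * Perfect matchings inside a component *)

Lemma involution_perfect_matching (H : sgraph) (g : H -> H) :
  involutive g -> (forall x, x -- g x) ->
  exists M : {set {set H}}, perfect_matching M.
Proof.
move=> gK gadj; pose e x := [set x; g x]; exists [set e x | x : H]; apply/and3P; split.
- apply/subsetP=> _ /imsetP[x _ ->]; apply/imsetP; exists (x, g x) => //.
  by rewrite inE /= gadj.
- have memE x y : y \in e x -> e x = e y.
    by rewrite /e; case/set2P=> -> //; rewrite gK setUC.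
  apply/trivIsetP=> _ _ /imsetP[x _ ->] /imsetP[y _ ->]; apply: contraR.
  by rewrite -setI_eq0 => /set0Pn[z /setIP[/memE-> /memE->]].
apply/eqP/setP=> x; rewrite inE; apply/bigcupP.
by exists (e x); rewrite ?imset_f // set21.
Qed.

Theorem theoreml (G : sgraph) (triG : triangle_free G) (critG : gap_critical G)
    (C : {set G}) (compC : C \in components G) :
  factor_critical (induced C).
Proof.
move=> v; have missable u := gap_critical_missable u triG critG.
have [f maxf fv] := missable (val v); have [[fK fadj] _] := maxf.
case/imsetP: compC => r _ defC.
have connC x : (x \in C) = connect (@adj G) r x by rewrite defC inE.
have csym : connect_sym (@adj G).
  by apply: sym_connect_sym; apply: adj_sym.
have valv (x : del_vertex v) : val x != v by have := valP x; rewrite !inE.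
(* Any two vertices of [C] are connected, so [f] misses no vertex of [C] besides [v]. *)
have fC x : x \in C -> x != val v -> x -- f x.
  move=> xC nx; apply: fadj; apply: contraNneq nx => fx; apply/eqP.
  apply: (connect_never_both_missed missable) maxf fx fv.
  by apply: (connect_trans (y := r)); rewrite -?connC ?(valP v) // csym -connC.
(* [f] restricts to the component without [v]: [f x] is a neighbour of [x], hence in [C], and is not
   [v] because [f] fixes [v]. *)
have /fin_all_exists[g gE] (x : del_vertex v) :
    exists y : del_vertex v, val (val y) = f (val (val x)).
  have xf := fC _ (valP (val x)) (valv x).
  have yC : f (val (val x)) \in C.
    by have := valP (val x); rewrite /= !connC => /connect_trans; apply; apply: connect1.
  have yv : (Sub (f (val (val x))) yC : induced C) \in [set~ v].
    rewrite !inE -val_eqE SubK (inv_eq fK) fv val_eqE.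
    exact: valv.
  by exists (Sub (Sub (f (val (val x))) yC : induced C) yv).
apply: (involution_perfect_matching (g := g)) => x.
  by do 2!apply: val_inj; rewrite !gE fK.
by rewrite /= /induced_adj /= /induced_adj gE; apply: fC (valP (val x)) (valv x).
Qed.
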